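(* Let $\mathcal{V}$ be a Hilbert space, $\mathcal{V}_h\subset\mathcal{V}_h^{+}\subset\mathcal{V}$ finite dimensional (finite element) subspaces, $B(\cdot,\cdot):\mathcal{V}\times\mathcal{V}\to\mathbb{R}$ a bilinear form, $L:\mathcal{V}\to\mathbb{R}$ a linear functional, and $J:\mathcal{V}\to\mathbb{R}$ a nonlinear functional. Let $u\in\mathcal{V}$ denote the solution of $B(u,\varphi)=L(\varphi)$ for all $\varphi\in\mathcal{V}$, and let $u_h\in\mathcal{V}_h$, $u_h^{+}\in\mathcal{V}_h^{+}$ and $z_h^{+}\in\mathcal{V}_h^{+}$ solve, respectively, $$B(u_h,\varphi_h)=L(\varphi_h)\quad\forall\varphi_h\in\mathcal{V}_h,$$ $$B(u_h^{+},\varphi_h^{+})=L(\varphi_h^{+})\quad\forall\varphi_h^{+}\in\mathcal{V}_h^{+},$$ $$B(\varphi_h^{+},z_h^{+})=J'(u_h;\varphi_h^{+})\quad\forall\varphi_h^{+}\in\mathcal{V}_h^{+}.$$ Let $e_h^{+}:=u_h^{+}-u_h$, and let $J$ be chosen so that $J'(u_h;e_h^{+})=B(e_h^{+},\psi_h)$ for some $\psi_h\in\mathcal{V}_h$. Then the estimate $\eta_3\approx J(u)-J(u_h)$ given by $$\eta_3:=L(z_h^{+})-B(u_h,z_h^{+})$$ is not reliable.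
   Context: Derivatives: $J'(u;v):=\lim_{\varepsilon\to0}\varepsilon^{-1}[J(u+\varepsilon v)-J(u)]$ and $J''(u;v,w):=\lim_{\varepsilon\to0}\varepsilon^{-1}[J'(u+\varepsilon w;v)-J'(u;v)]$. Standing assumptions: $J$ has sufficient regularity such that its first and second Fréchet derivatives exist (these agree with $J'$ and $J''$), and the problem of finding $u\in\mathcal{V}$ with $B(u,\varphi)=L(\varphi)$ for all $\varphi\in\mathcal{V}$ is well-posed. Definition (reliable): an error estimate $\eta\approx J(u)-J(u_h)$ is said to be reliable if there exists a constant $C\in\mathbb{R}_{>0}$ independent of $u_h$ such that $|J(u)-J(u_h)|\le C|\eta|$.
   Formalization: The formal theorem adds the hypothesis that J(u) ≠ J(u_h) (at the discretization where J'(u_h;e_h^+)=B(e_h^+,ψ_h)); without it the claim fails, e.g. for constant J, where error and estimate both vanish. *)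

(* Defs.v *)
From HB Require Import structures.
From mathcomp Require Import all_boot all_order all_algebra.
From mathcomp Require Import all_classical all_reals all_analysis.

Set Implicit Arguments.
Unset Strict Implicit.
Unset Printing Implicit Defensive.

Import Order.TTheory GRing.Theory Num.Theory.
Import numFieldNormedType.Exports.

Local Open Scope classical_set_scope.
Local Open Scope ring_scope.

(* Real Hilbert space: complete, and the norm comes from an inner product. *)
Definition is_hilbert (R : realType) (V : completeNormedModType R) : Prop :=
  exists dot : {dot V for idfun}, forall x : V, `|x| ^+ 2 = dot x x.

Definition finite_dim_subspace (R : realType) (V : normedModType R)
    (W : set V) : Prop :=
  exists (n : nat) (e : 'I_n -> V),
    W = [set \sum_(i < n) a i *: e i | a in [set: 'I_n -> R]].

(* w belongs to W and satisfies the problem posed with trial and test space W;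
   W = setT gives the problem on the whole space. *)
Definition solves (R : realType) (V : normedModType R)
    (B : {biscalar V}) (L : {scalar V}) (W : set V) (w : V) : Prop :=
  W w /\ forall phi, W phi -> B w phi = L phi.

(* Well-posedness in the sense of Hadamard: existence, uniqueness, and
   continuous dependence on the datum L, perturbations of L being measured in
   the dual norm.  L itself is not required to be bounded. *)
Definition well_posed (R : realType) (V : normedModType R)
    (B : {biscalar V}) (L : {scalar V}) : Prop :=
  exists u : V,
    [/\ solves B L setT u,
        forall u', solves B L setT u' -> u' = u
      & exists2 K : R, 0 <= K &
          forall (L' : {scalar V}) (u' : V) (c : R), 0 <= c ->
            (forall phi, `|L phi - L' phi| <= c * `|phi|) ->
            solves B L' setT u' -> `|u - u'| <= K * c].

(* The library has no normed space of bounded linear functionals, so Frechet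
   differentiability of x |-> 'd J x at x, in the dual norm, is spelled out; A
   is the second derivative at x, seen as a bounded bilinear form. *)
Definition twice_frechet_differentiable (R : realType) (V : normedModType R)
    (J : V -> R) : Prop :=
  (forall x : V, differentiable J x) /\
  forall x : V, exists A : {biscalar V},
    (exists M : R, forall v w, `|A v w| <= M * `|v| * `|w|) /\
    forall eps : R, 0 < eps ->
      \forall k \near (0 : V), forall v : V,
        `|'d J (x + k) v - 'd J x v - A v k| <= eps * `|k| * `|v|.

(* The estimate is a rule assigning a number eta h to every discretization h in
   the family H, and the constant is uniform over that family: this is what
   "independent of u_h" means. *)
Definition reliable (R : realType) (V : normedModType R) (H : Type)
    (J : V -> R) (u : V) (uh : H -> V) (eta : H -> R) : Prop :=
  exists2 C : R, 0 < C & forall h : H, `|J u - J (uh h)| <= C * `|eta h|.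

(* Main.v *)
Require Import Defs.
From HB Require Import structures.
From mathcomp Require Import all_boot all_order all_algebra.
From mathcomp Require Import all_classical all_reals all_analysis.

Import Order.TTheory GRing.Theory Num.Theory.
Import numFieldNormedType.Exports.

Local Open Scope classical_set_scope.
Local Open Scope ring_scope.

(** The estimate vanishes at the discretization [h0], although the error does
    not.  Write [e := uhp h0 - uh h0], an element of [Vhp h0].  The enriched
    primal problem tested with [zhp h0] turns the residual
    [L (zhp h0) - B (uh h0) (zhp h0)] into [B e (zhp h0)]; the enriched dual
    problem tested with [e] turns this into the derivative of [J] at [uh h0] in
    the direction [e], that is, by the choice of [J], into [B e psi] for some
    [psi] in [Vh h0].  This last number is zero by Galerkin orthogonality
    ([galerkin_orthogonality]): the primal problems on [Vh h0] and on
    [Vhp h0] can both be tested with [psi].  A bound of the error by a multiple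
    of the estimate would thus force [J u = J (uh h0)]. *)

Lemma finite_dim_subspaceB {R : realType} {V : normedModType R} {W : set V}
    {x y : V} :
  finite_dim_subspace W -> W x -> W y -> W (x - y).
Proof.
move=> [n [e ->]] [a _ <-] [b _ <-]; exists (fun i => a i - b i) => //.
by rewrite -sumrB; apply: eq_bigr => i _; rewrite scalerBl.
Qed.

Lemma solves_residual {R : realType} {V : normedModType R}
    {B : {biscalar V}} {L : {scalar V}} {W : set V} {w} (v : V) {phi : V} :
  solves B L W w -> W phi -> L phi - B v phi = B (w - v) phi.
Proof. by move=> [_ Bw] Wphi; rewrite linearBl Bw. Qed.

Lemma galerkin_orthogonality {R : realType} {V : normedModType R}
    {B : {biscalar V}} {L : {scalar V}} {W Wp : set V} {w wp phi : V} :
  W `<=` Wp -> solves B L W w -> solves B L Wp wp -> W phi ->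
  B (wp - w) phi = 0.
Proof.
move=> WWp [_ Bw] swp Wphi.
by rewrite -(solves_residual _ swp (WWp _ Wphi)) Bw // subrr.
Qed.

Theorem theorem2 (R : realType) (V : completeNormedModType R)
    (hV : is_hilbert V)
    (B : {biscalar V}) (L : {scalar V}) (J : V -> R)
    (hwp : well_posed B L)
    (hJ : twice_frechet_differentiable J)
    (H : Type) (Vh Vhp : H -> set V)
    (hVh : forall h, finite_dim_subspace (Vh h))
    (hVhp : forall h, finite_dim_subspace (Vhp h))
    (hsub : forall h, Vh h `<=` Vhp h)
    (u : V) (hu : solves B L setT u)
    (uh uhp zhp : H -> V)
    (huh : forall h, solves B L (Vh h) (uh h))
    (huhp : forall h, solves B L (Vhp h) (uhp h))
    (hzhp : forall h, Vhp h (zhp h))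
    (hdual : forall h phi, Vhp h phi -> B phi (zhp h) = 'D_phi J (uh h))
    (h0 : H)
    (hchoice : exists2 psi : V, Vh h0 psi &
       'D_(uhp h0 - uh h0) J (uh h0) = B (uhp h0 - uh h0) psi)
    (herr : J u <> J (uh h0)) :
  ~ reliable J u uh (fun h => L (zhp h) - B (uh h) (zhp h)).
Proof.
move=> [C _ /(_ h0)].
have [[uhW _] [uhpW _]] := (huh h0, huhp h0).
have eW : Vhp h0 (uhp h0 - uh h0).
  by apply: finite_dim_subspaceB uhpW _ => //; exact: hsub uhW.
have [psi psiW Dpsi] := hchoice.
rewrite (solves_residual _ (huhp h0) (hzhp h0)) hdual // Dpsi.
rewrite (galerkin_orthogonality (hsub h0) (huh h0) (huhp h0) psiW).
by rewrite normr0 mulr0 normr_le0 subr_eq0 => /eqP.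
Qed.
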